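(* Let $d \ge 1$. 1. For every fixed positive integer $t$ and every fixed $d$-dimensional 0-1 matrix $P$ with at least two ones, $$\operatorname{ex}(n, Q_{P,t},d+1) = O\left(\operatorname{ex}(n, P, d)^{1/t}\, n^{d+1-d/t}\right).$$ 2. For every fixed positive integer $t$ and every fixed $d$-dimensional 0-1 matrix $P$ with $\operatorname{ex}(n, P, d) = O(n^{d-1})$, we have $\operatorname{ex}(n, Q_{P,t},d+1) = O(n^{d+1-1/t})$. In particular, $\operatorname{ex}(n, Q_{P,2}, d+1) = \Theta(n^{d+1/2})$ for every $d$-dimensional 0-1 matrix $P$ with at least two ones such that $\operatorname{ex}(n, P, d) = O(n^{d-1})$. Moreover, $\operatorname{ex}(n, Q_{P,3}, d+1) = \Theta(n^{d+2/3})$ for every $d$-dimensional 0-1 matrix $P$ with at least three ones differing in the first coordinate (i.e. having three ones whose first coordinates are pairwise distinct) such that $\operatorname{ex}(n, P, d) = O(n^{d-1})$.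
   Context: A $d$-dimensional 0-1 matrix is a $d$-dimensional array, of some dimensions $n_1\times\cdots\times n_d$, with entries in $\{0,1\}$; it has sidelength $n$ if $n_1=\cdots=n_d=n$. A submatrix is obtained by choosing a subset of the indices in each of the $d$ coordinates (keeping their order). A $d$-dimensional 0-1 matrix $A$ contains a $d$-dimensional 0-1 matrix $B$ if some submatrix of $A$ can be turned into $B$ by changing some number (possibly zero) of ones to zeroes; otherwise $A$ avoids $B$. For a $d$-dimensional 0-1 matrix $Q$, $\operatorname{ex}(n,Q,d)$ is the maximum number of ones in a $d$-dimensional 0-1 matrix of sidelength $n$ that avoids $Q$. For a $d$-dimensional 0-1 matrix $P$ and a positive integer $t$, $Q_{P,t}$ is the $(d+1)$-dimensional 0-1 matrix obtained from $P$ by stacking $t$ copies of $P$ with the same orientation in the direction of the new dimension, i.e. $Q_{P,t}$ has length $t$ in the new coordinate and each of its $t$ slices orthogonal to that direction equals $P$. (For example, if $P$ is the $4\times 1$ all-ones matrix, then $Q_{P,t}$ is the $4\times t$ all-ones matrix.) Asymptotic notation is as $n\to\infty$ with $d$, $t$, $P$ fixed; implied constants may depend on these fixed parameters. *)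

(* Defs.v *)
From mathcomp Require Import all_boot.

Set Implicit Arguments.
Unset Strict Implicit.
Unset Printing Implicit Defensive.

(* s gives the sidelengths n_1, ..., n_d; coordinates are 0-based. *)
Definition position (d : nat) (s : 'I_d -> nat) : finType :=
  {dffun forall i : 'I_d, 'I_(s i)}.

Definition mx01 (d : nat) (s : 'I_d -> nat) : finType := {ffun position s -> bool}.

Definition ones (d : nat) (s : 'I_d -> nat) (A : mx01 s) : nat :=
  #|[set x : position s | A x]|.

(* A choice of s' i indices in each coordinate i of an array with sidelengths
   s, each chosen set being given by its increasing enumeration. *)
Definition selection (d : nat) (s' s : 'I_d -> nat) : finType :=
  {dffun forall i : 'I_d, {ffun 'I_(s' i) -> 'I_(s i)}}.

Definition order_preserving (d : nat) (s' s : 'I_d -> nat)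
    (f : selection s' s) : bool :=
  [forall i, forall j : 'I_(s' i), forall k : 'I_(s' i),
     (j < k) ==> (f i j < f i k)].

Definition submx01 (d : nat) (s' s : 'I_d -> nat)
    (f : selection s' s) (A : mx01 s) : mx01 s' :=
  [ffun x : position s' => A [ffun i : 'I_d => f i (x i)]].

Definition contains (d : nat) (s s' : 'I_d -> nat)
    (A : mx01 s) (B : mx01 s') : bool :=
  [exists f : selection s' s,
     order_preserving f && [forall x, B x ==> submx01 f A x]].

Definition avoids (d : nat) (s s' : 'I_d -> nat)
    (A : mx01 s) (B : mx01 s') : bool :=
  ~~ contains A B.

(* The value is 0 when no matrix of sidelength n avoids Q. *)
Definition extremal (n d : nat) (s : 'I_d -> nat) (Q : mx01 s) : nat :=
  \max_(A : mx01 (fun _ : 'I_d => n) | avoids A Q) ones A.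

(* The new coordinate of Q_{P,t} is the last one. *)
Definition stack_size (d : nat) (s : 'I_d -> nat) (t : nat) : 'I_d.+1 -> nat :=
  fun i => if unlift ord_max i is Some j then s j else t.

Lemma stack_size_lift (d : nat) (s : 'I_d -> nat) (t : nat) (i : 'I_d) :
  stack_size s t (lift ord_max i) = s i.
Proof. by rewrite /stack_size liftK. Qed.

Definition stack (d : nat) (s : 'I_d -> nat) (P : mx01 s) (t : nat) :
    mx01 (stack_size s t) :=
  [ffun x : position (stack_size s t) =>
     P [ffun i : 'I_d => cast_ord (stack_size_lift s t i) (x (lift ord_max i))]].

(* Main.v *)
(* Upper bounds, after Kővári–Sós–Turán: for a t-set T of indices in the new coordinate, the positions x
   whose column contains T form a matrix avoiding P.  Counting the pairs (x, T)
   by columns and applying the power mean inequality gives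
   (ex(n, Q_{P,t}) - t n^d)^t <= n^(d(t-1)+t) ex(n, P), and t n^d is absorbed
   because t >= 1 (and, in the first bound, because ex(n, P) >= n^(d-1)).
   Lower bounds: if P has t ones with distinct i-th coordinates and B is an
   n x n incidence matrix without K_{t,t}, then A(x) = B(x_i, x_{d+1}) avoids
   Q_{P,t} and has n^(d-1) |B| ones.  For t = 2, B is the point-line incidence
   A + B = ab over F_q; for t = 3, it is the projective norm graph
   N(A + B) = ab of Alon, Rónyai and Szabó, with A, B in F_{q^2} and a, b in
   F_q^*.  Taking q = 2^k avoids any result on the distribution of primes. *)

Require Import Defs.
From mathcomp Require Import all_boot all_order all_algebra all_field.
From mathcomp Require Import all_classical all_reals all_analysis.
From mathcomp Require Import zify ring lra.
Import Order.TTheory GRing.Theory Num.Theory.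
Import numFieldNormedType.Exports.

Set Implicit Arguments.
Unset Strict Implicit.
Unset Printing Implicit Defensive.

(** * Upper bounds *)

(** The type of a value depends on its index, so a plain case analysis on [unlift] would not
    typecheck. The values are transported along the equation given by [unliftP], and irrelevance of
    equality proofs on ordinals removes the transport. *)
Lemma lift_max_dfun (d : nat) (T : 'I_d.+1 -> Type)
    (F : forall k, T (lift ord_max k)) (y : T ord_max) :
  {g : forall i, T i | (forall k, g (lift ord_max k) = F k) & g ord_max = y}.
Proof.
exists (fun i => match unliftP ord_max i with
  | UnliftSome k e => eq_rect_r T (F k) e
  | UnliftNone e => eq_rect_r T y e
  end).
- move=> k; case: unliftP => [k' e|e]; last by case/eqP: (neq_lift ord_max k).
  have ek := lift_inj e; subst k'.
  by rewrite (eq_irrelevance e erefl).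
- case: unliftP => [k e|e]; first by case/eqP: (neq_lift ord_max k).
  by rewrite (eq_irrelevance e erefl).
Qed.

Lemma stack_size_max (d : nat) (s : 'I_d -> nat) (t : nat) :
  stack_size s t ord_max = t.
Proof. by rewrite /stack_size unlift_none. Qed.

(** The enumeration of a set of ordinals filters the increasing list of all ordinals. This makes a
    set of levels usable as the last component of an order-preserving selection. *)
Lemma enum_val_lt (n : nat) (T : {set 'I_n}) (a b : 'I_#|T|) :
  a < b -> enum_val a < enum_val b.
Proof.
move=> ab; case: n => [|n] in T a b ab *; first by case: (enum_val a).
have srt : sorted (fun i j : 'I_n.+1 => i < j) (enum T).
  rewrite {1}/enum_mem -enumT; apply: sorted_filter; first by move=> i j k; apply: ltn_trans.
  by have := iota_ltn_sorted 0 n.+1; rewrite -val_enum_ord sorted_map.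
rewrite !(enum_val_nth ord0).
have tr : transitive (fun i j : 'I_n.+1 => i < j) by move=> i j k; apply: ltn_trans.
by apply: (sorted_ltn_nth tr ord0 srt) => //; rewrite inE -cardE ltn_ord.
Qed.

Definition extend (d n : nat) (x : position (fun _ : 'I_d => n)) (j : 'I_n) :
    position (fun _ : 'I_d.+1 => n) :=
  [ffun i => if unlift ord_max i is Some k then x k else j].

Definition column (d n : nat) (A : mx01 (fun _ : 'I_d.+1 => n))
    (x : position (fun _ : 'I_d => n)) : {set 'I_n} :=
  [set j | A (extend x j)].

Definition slice (d n : nat) (A : mx01 (fun _ : 'I_d.+1 => n))
    (T : {set 'I_n}) : mx01 (fun _ : 'I_d => n) :=
  [ffun x => T \subset column A x].

(** Contrapositive: a copy of [P] in the slice, extended in the last coordinate by the increasing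
    enumeration of [T], is a copy of [stack P t] in [A]. *)
Lemma slice_avoids (d n t : nat) (s : 'I_d -> nat) (P : mx01 s)
    (A : mx01 (fun _ : 'I_d.+1 => n)) (T : {set 'I_n}) :
  #|T| = t -> avoids A (stack P t) -> avoids (slice A T) P.
Proof.
move=> cT; apply: contra => /existsP[f /andP[/forallP fmon /forallP fP]].
have emax : stack_size s t ord_max = #|T| by rewrite stack_size_max.
have [g gl gm] := @lift_max_dfun d (fun i => {ffun 'I_(stack_size s t i) -> 'I_n})
  (fun k => [ffun j => f k (cast_ord (stack_size_lift s t k) j)])
  [ffun j => enum_val (cast_ord emax j)].
apply/existsP; exists [ffun i => g i]; apply/andP; split.
  apply/forallP => i; apply/forallP => j; apply/forallP => k; apply/implyP => jk.
  rewrite !ffunE; case: (unliftP ord_max i) => [i' e|e]; subst i.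
    rewrite gl !ffunE.
    by have /forallP/(_ (cast_ord (stack_size_lift s t i') j))/forallP
         /(_ (cast_ord (stack_size_lift s t i') k))/implyP := fmon i'; apply.
  by rewrite gm !ffunE; apply: enum_val_lt.
apply/forallP => z; apply/implyP; rewrite !ffunE => Pz.
have := fP [ffun k => cast_ord (stack_size_lift s t k) (z (lift ord_max k))].
rewrite Pz /= !ffunE => /fintype.subsetP/(_ (g ord_max (z ord_max))).
rewrite {1}gm ffunE enum_valP => /(_ isT); rewrite inE.
congr (A _); apply/ffunP => i; rewrite !ffunE.
case: unliftP => [k e|e]; subst i; last by [].
by rewrite !ffunE gl !ffunE.
Qed.

Lemma ones_columns (d n : nat) (A : mx01 (fun _ : 'I_d.+1 => n)) :
  ones A = \sum_(x : position (fun _ : 'I_d => n)) #|column A x|.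
Proof.
under [RHS]eq_bigr => x _ do rewrite -sum1dep_card.
rewrite pair_big_dep /= /ones -sum1dep_card.
rewrite (reindex (fun p => @extend d n p.1 p.2)) //=.
exists (fun z => ([ffun k => z (lift ord_max k)], z ord_max)) => [[x j]|z] _ /=.
  rewrite ffunE unlift_none; congr pair.
  by apply/ffunP => k; rewrite !ffunE liftK.
by apply/ffunP => i; rewrite !ffunE; case: unliftP => [k|] ->; rewrite ?ffunE.
Qed.

Lemma sum_bin_columns (d n t : nat) (s : 'I_d -> nat) (P : mx01 s)
    (A : mx01 (fun _ : 'I_d.+1 => n)) :
  avoids A (stack P t) ->
  \sum_(x : position (fun _ : 'I_d => n)) 'C(#|column A x|, t)
    <= 'C(n, t) * extremal n P.
Proof.
move=> av.
have -> : \sum_(x : position (fun _ : 'I_d => n)) 'C(#|column A x|, t) =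
          \sum_(T : {set 'I_n} | #|T| == t) ones (slice A T).
  under eq_bigr => x _ do rewrite -cards_draws -sum1dep_card.
  rewrite (exchange_big_dep (fun T : {set 'I_n} => #|T| == t)) /=; last first.
    by move=> x T _ /andP[].
  apply: eq_bigr => T cT; rewrite /ones -sum1dep_card.
  by apply: eq_bigl => x; rewrite /slice ffunE cT andbT.
apply: leq_trans (_ : \sum_(T : {set 'I_n} | #|T| == t) extremal n P <= _).
  apply: leq_sum => T /eqP cT.
  by apply: leq_bigmax_cond; apply: slice_avoids av.
rewrite sum_nat_cond_const leq_mul2r; apply/orP; right.
have := card_draws 'I_n t; rewrite card_ord => <-.
by rewrite cardsE.
Qed.

(** Chebyshev's sum inequality: sum (x - y)(x^t - y^t) >= 0, written without subtraction, over all
    pairs of values of [a]. *)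
Lemma chebyshev_powers (I : finType) (a : I -> nat) (t : nat) :
  (\sum_i a i) * (\sum_i a i ^ t) <= #|I| * \sum_i a i ^ t.+1.
Proof.
have two (x y : nat) : x * y ^ t + y * x ^ t <= x ^ t.+1 + y ^ t.+1.
  wlog xy : x y / x <= y.
    by move=> H; case: (leqP x y) => [/H //|/ltnW/H]; rewrite addnC (addnC (y ^ _)).
  have : x ^ t <= y ^ t by case: (t) => // t'; rewrite leq_exp2r.
  rewrite !expnS; move: (x ^ t) (y ^ t) => u v; nia.
rewrite -leq_double -!addnn.
have -> : #|I| * \sum_i a i ^ t.+1 + #|I| * \sum_i a i ^ t.+1 =
  \sum_i \sum_j (a i ^ t.+1 + a j ^ t.+1).
  under [RHS]eq_bigr => i _ do rewrite big_split /= sum_nat_const.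
  by rewrite big_split /= -big_distrr /= sum_nat_const.
have -> : (\sum_i a i) * (\sum_i a i ^ t) + (\sum_i a i) * (\sum_i a i ^ t) =
  \sum_i \sum_j (a i * a j ^ t + a j * a i ^ t).
  under [RHS]eq_bigr => i _ do
    rewrite big_split /= -big_distrr -big_distrl /=.
  by rewrite big_split /= -big_distrl -big_distrr.
by apply: leq_sum => i _; apply: leq_sum => j _.
Qed.

Lemma power_mean (I : finType) (a : I -> nat) (t : nat) :
  (\sum_i a i) ^ t.+1 <= #|I| ^ t * \sum_i a i ^ t.+1.
Proof.
elim: t => [|t IH]; first by rewrite mul1n expn1; under [X in _ <= X]eq_bigr do rewrite expn1.
rewrite expnS (leq_trans (leq_mul (leqnn _) IH)) // mulnCA expnSr -mulnA.
by rewrite leq_mul2l chebyshev_powers orbT.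
Qed.

(** Each of the t factors is at least c - t; truncated subtraction covers c < t. *)
Lemma ffact_lower (c t : nat) : (c - t) ^ t <= c ^_ t.
Proof.
elim: t c => [|t IH] c //; case: c => [|c]; first by rewrite sub0n exp0n.
rewrite ffactSS subSS expnS leq_mul //; lia.
Qed.

Lemma ffact_upper (c t : nat) : c ^_ t <= c ^ t.
Proof.
elim: t => [|t IH] //; rewrite ffactnSr expnSr leq_mul //; lia.
Qed.

Lemma card_box (d n : nat) (F : forall i : 'I_d, pred 'I_n) :
  #|[set x : position (fun _ : 'I_d => n) | [forall i, F i (x i)]]|
    = \prod_i #|F i|.
Proof.
have := @card_family 'I_d (fun=> 'I_n) F.
rewrite foldrE big_map big_enum /= => <-.
by apply: eq_card => x; rewrite !inE.
Qed.

Lemma card_cube (d n : nat) : #|position (fun _ : 'I_d => n)| = n ^ d.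
Proof.
transitivity (\prod_(i < d) #|(fun=> true) : pred 'I_n|).
  by rewrite -card_box; apply: eq_card => x; rewrite inE; apply/esym/forallP.
under eq_bigr => i _ do rewrite card_ord.
by rewrite prod_nat_const card_ord.
Qed.

Lemma card_hyperplane (d n : nat) (i : 'I_d) (a : 'I_n) :
  #|[set x : position (fun _ : 'I_d => n) | x i == a]| = n ^ d.-1.
Proof.
transitivity (\prod_(k < d) #|(fun b => (k == i) ==> (b == a))|).
  rewrite -card_box; apply: eq_card => x; rewrite !inE; apply/idP/forallP.
    by move=> xa k; apply/implyP => /eqP ->.
  by move/(_ i); rewrite eqxx.
rewrite (bigD1 i) //= eqxx (eq_card (B := pred1 a)) // card1 mul1n.
under eq_bigr => k ki do rewrite (negbTE ki) card_ord.
by rewrite prod_nat_const cardC1 card_ord.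
Qed.

Lemma extremal_stack_upper (d n t : nat) (s : 'I_d -> nat) (P : mx01 s) :
  0 < t ->
  (extremal n (stack P t) - t * n ^ d) ^ t
    <= n ^ (d * t.-1 + t) * extremal n P.
Proof.
case: t => // t _; rewrite /extremal.
(* The bound holds for 0 and passes to maxima, so it suffices to prove it for one avoiding matrix,
   even if none exists. *)
elim/big_ind: _ => [|x y Kx Ky|A av]; first by rewrite sub0n exp0n.
  by rewrite /maxn; case: ifP.
set a := fun x => #|column A x| - t.+1.
have le_sum : ones A - t.+1 * n ^ d <= \sum_x a x.
  rewrite leq_subLR -card_cube mulnC -sum_nat_const -big_split /=.
  rewrite ones_columns; apply: leq_sum => x _.
  by rewrite /a -leq_subLR.
apply: leq_trans (_ : (\sum_x a x) ^ t.+1 <= _); first by rewrite leq_exp2r.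
apply: leq_trans (power_mean a t) _.
rewrite card_cube -expnM /= expnD -mulnA leq_mul2l; apply/orP; right.
(* Here (c - t)^t <= t! C(c, t) for each column; after the double count, t! C(n, t) is a falling
   factorial, at most n^t. *)
apply: leq_trans (_ : \sum_(x : position (fun _ : 'I_d => n))
  'C(#|column A x|, t.+1) * t.+1`! <= _).
  by apply: leq_sum => x _; rewrite bin_ffact; apply: ffact_lower.
rewrite -big_distrl /= mulnC.
apply: leq_trans (leq_mul (leqnn _) (sum_bin_columns av)) _.
by rewrite mulnA (mulnC _`!) bin_ffact leq_mul2r ffact_upper orbT.
Qed.

(** * Lower bounds from biclique-free graphs *)

Lemma order_preserving_inj (d : nat) (s' s : 'I_d -> nat) (f : selection s' s) i :
  order_preserving f -> injective (f i).
Proof.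
move=> /forallP/(_ i)/forallP fmon j k fjk; apply: val_inj.
case: (ltngtP j k) => // jk.
  by move/forallP: (fmon j) => /(_ k); rewrite jk fjk ltnn.
by move/forallP: (fmon k) => /(_ j); rewrite jk fjk ltnn.
Qed.

(** [B] is read as a bipartite incidence relation between two copies of [V], so the images of [f]
    and [g] may overlap. *)
Definition biclique_free (V : Type) (t : nat) (B : rel V) : Prop :=
  forall f g : 'I_t -> V, injective f -> injective g ->
    ~ forall a b, B (f a) (g b).

Lemma two_ones (d : nat) (s : 'I_d -> nat) (P : mx01 s) :
  2 <= ones P -> exists x y i, [/\ P x, P y & x i != y i].
Proof.
case/card_gt1P => x [y [+ + xy]]; rewrite !inE => Px Py.
suff /existsP[i xyi] : [exists i, x i != y i] by exists x, y, i.
apply: contraNT xy; rewrite negb_exists => /forallP H.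
by apply/eqP/ffunP => i; apply/eqP; move: (H i); rewrite negbK.
Qed.

(** A full hyperplane x_i = 0 avoids [P]: two ones of [P] that differ in coordinate i would need two
    distinct indices there. *)
Lemma extremal_lower (d n : nat) (s : 'I_d -> nat) (P : mx01 s) :
  2 <= ones P -> 0 < n -> n ^ d.-1 <= extremal n P.
Proof.
move=> /two_ones[x [y [i [Px Py xy]]]] n0.
pose A : mx01 (fun _ : 'I_d => n) :=
  [ffun z : position (fun _ : 'I_d => n) => z i == Ordinal n0].
have -> : n ^ d.-1 = ones A.
  rewrite -(card_hyperplane i (Ordinal n0)).
  by apply: eq_card => z; rewrite !inE ffunE.
apply: leq_bigmax_cond; apply/existsP => -[f /andP[fmon /forallP fP]].
move: (fP x) (fP y); rewrite Px Py !ffunE /= ?ffunE => /eqP fx /eqP fy.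
by move: xy; rewrite (order_preserving_inj fmon (etrans fx (esym fy))) eqxx.
Qed.

(** A copy of the stack contains the ones [u a] at all levels b; their i-th coordinates and their
    levels would span a K_{t,t} in [B]. Each edge of [B] is repeated at n^(d-1) positions. *)
Lemma extremal_stack_lower (d n t : nat) (s : 'I_d -> nat) (P : mx01 s)
    (i : 'I_d) (u : 'I_t -> position s) (B : rel 'I_n) :
  (forall k, P (u k)) -> injective (fun k => u k i) ->
  biclique_free t B ->
  n ^ d.-1 * #|[set e | B e.1 e.2]| <= extremal n (stack P t).
Proof.
move=> Pu uinj Bfree.
pose A : mx01 (fun _ : 'I_d.+1 => n) :=
  [ffun z : position (fun _ : 'I_d.+1 => n) => B (z (lift ord_max i)) (z ord_max)].
have -> : n ^ d.-1 * #|[set e | B e.1 e.2]| = ones A.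
  have -> : #|[set e | B e.1 e.2]| = \sum_a #|[set b | B a b]|.
    rewrite -sum1dep_card -(pair_big_dep xpredT B (fun _ _ => 1)) /=.
    by apply: eq_bigr => a _; rewrite sum1dep_card.
  rewrite ones_columns big_distrr /=.
  rewrite [RHS](partition_big (fun x : position (fun _ : 'I_d => n) => x i) xpredT) //=.
  apply: eq_bigr => a _; rewrite -(card_hyperplane i a) -sum_nat_cond_const.
  apply: eq_big => [x|x /eqP xa]; first by rewrite ?inE.
  apply: eq_card => j; rewrite !inE !ffunE liftK unlift_none.
  by rewrite xa.
apply: leq_bigmax_cond; apply/existsP => -[f /andP[fmon /forallP fP]].
have tE := stack_size_max s t.
apply: (Bfree (fun a => f (lift ord_max i) (cast_ord (esym (stack_size_lift s t i)) (u a i)))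
  (fun b => f ord_max (cast_ord (esym tE) b))).
- by move=> a b /(order_preserving_inj fmon)/cast_ord_inj/uinj.
- by move=> a b /(order_preserving_inj fmon)/cast_ord_inj.
move=> a b.
have [z zl zm] := @lift_max_dfun d (fun i => 'I_(stack_size s t i))
  (fun k => cast_ord (esym (stack_size_lift s t k)) (u a k)) (cast_ord (esym tE) b).
have /implyP := fP ([ffun i => z i] : position (stack_size s t)); rewrite !ffunE zl zm; apply.
suff -> : [ffun k => cast_ord (stack_size_lift s t k)
  (([ffun i => z i] : position (stack_size s t)) (lift ord_max k))] = u a by [].
by apply/ffunP => k; rewrite !ffunE zl cast_ordKV.
Qed.

(** * Dense biclique-free graphs over finite fields *)

Section FiniteFieldGraphs.

Local Open Scope ring_scope.

Lemma fin_K22_free (F : finFieldType) (v v' : F * F) (w w' : F * F) :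
  v.1 + w.1 = v.2 * w.2 -> v.1 + w'.1 = v.2 * w'.2 ->
  v'.1 + w.1 = v'.2 * w.2 -> v'.1 + w'.1 = v'.2 * w'.2 -> v = v' \/ w = w'.
Proof.
case: v v' w w' => [A a] [A' a'] [B b] [B' b'] /= e1 e2 e3 e4.
(* The alternating sum of the four equations cancels all first coordinates. *)
have /eqP : (a - a') * (b - b') = 0.
  transitivity ((a * b - a' * b) - (a * b' - a' * b')); first by ring.
  by rewrite -e1 -e2 -e3 -e4; ring.
rewrite mulf_eq0 !subr_eq0 => /orP[] /eqP ?; subst.
  by left; congr pair; apply: (addIr B); rewrite e1 e3.
by right; congr pair; apply: (addrI A); rewrite e1 e2.
Qed.

Section NormGraph.

Variables (L : finFieldType) (q : nat).
Hypotheses (cardL : #|L| = (q ^ 2)%N) (q_gt1 : (1 < q)%N)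
  (qD : forall x y : L, (x + y) ^+ q = x ^+ q + y ^+ q).

(** The norm of F_{q^2} over F_q, with values kept in [L]. Hypothesis [qD] makes the conjugation x
    -> x^q additive. *)
Definition norm (x : L) : L := x ^+ q.+1.

Lemma normM x y : norm (x * y) = norm x * norm y.
Proof. exact: exprMn. Qed.

Lemma norm_eq0 x : (norm x == 0) = (x == 0).
Proof. by rewrite expf_eq0. Qed.

Lemma normE x : norm x = x * x ^+ q. Proof. exact: exprS. Qed.

Lemma qB (x y : L) : (x - y) ^+ q = x ^+ q - y ^+ q.
Proof. by apply: (addIr (y ^+ q)); rewrite -qD !subrK. Qed.

(* Subtracting the two norm equations gives a linear relation between Y and
   Y^q; substituting it back leaves a quadratic equation for Y. *)
Lemma norm_pair_solutions (C1 C2 d1 d2 : L) (Y : 'I_3 -> L) :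
  C1 != C2 -> (forall k, norm (Y k + C1) = d1) -> (forall k, norm (Y k + C2) = d2) ->
  ~ injective Y.
Proof.
move=> C12 H1 H2 Yinj.
have en0 : C1 - C2 != 0 by rewrite subr_eq0.
pose D := C1 ^+ q - C2 ^+ q.
have Dn0 : D != 0 by rewrite /D -qB expf_neq0.
pose c := d1 - d2 - (C1 ^+ q * C1 - C2 ^+ q * C2).
have lin k : (Y k) ^+ q = (c - Y k * D) / (C1 - C2).
  apply/(canRL (mulfK en0)); rewrite /c -(H1 k) -(H2 k) !normE !qD /D; ring.
pose c' := c + (C1 - C2) * C1 ^+ q.
(* The expansion of (Y + C1)(c' - Y D) - (C1 - C2) d1. Its leading coefficient -D is nonzero, so it
   cannot have three distinct roots. *)
pose p := Poly [:: C1 * c' - (C1 - C2) * d1; c' - C1 * D; - D].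
have rp k : root p (Y k).
  rewrite /root /p horner_Poly /= -(H1 k) normE qD lin /c'.
  by apply/eqP; field; exact: en0.
have pn0 : p != 0.
  apply: contraNneq Dn0 => p0; have := coef_Poly [:: C1 * c' - (C1 - C2) * d1; c' - C1 * D; - D] 2.
  by rewrite -/p p0 coef0 /= => /esym/eqP; rewrite oppr_eq0.
have sp : (size p <= 3)%N by apply: size_Poly.
have := @max_poly_roots _ p (codom Y) pn0.
rewrite size_codom card_ord => /(_ _ _)/leq_trans/(_ sp); rewrite ltnn => H.
suff : false by [].
apply: H; first by apply/allP => _ /codomP[k ->].
by apply/injectiveP.
Qed.

(* F_q^* as a subgroup of L^* = F_{q^2}^*. *)
Definition fixed_units : {set L} := [set a | a ^+ q.-1 == 1].

Lemma card_fixed_units_le : (#|fixed_units| <= q.-1)%N.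
Proof.
have q1 : (0 < q.-1)%N by lia.
have := @max_poly_roots _ ('X^(q.-1) - 1 : {poly L}) (enum fixed_units).
rewrite size_XnsubC // -cardE ltnS; apply.
- by rewrite monic_neq0 // monicXnsubC.
- by apply/allP => a; rewrite mem_enum inE rootE !hornerE subr_eq0.
- exact: enum_uniq.
Qed.

Lemma norm_fixed (x : L) : x != 0 -> norm x \in fixed_units.
Proof.
(* Multiplying by x turns x^(q^2 - 1) = 1 into x^(q^2) = x, which holds in a field of q^2
   elements. *)
move=> x0; rewrite inE /norm -exprM; apply/eqP/(mulfI x0).
rewrite -exprS mulr1; rewrite -[RHS]expf_card cardL; congr (_ ^+ _).
nia.
Qed.

(* The norm map L^* -> F_q^* has fibres of size at most q + 1. *)
Lemma card_fixed_units_ge : (q.-1 <= #|fixed_units|)%N.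
Proof.
have fib (a : L) : (#|[set x | norm x == a]| <= q.+1)%N.
  have := @max_poly_roots _ ('X^(q.+1) - a%:P : {poly L}) (enum [set x | norm x == a]).
  rewrite size_XnsubC // -cardE ltnS; apply.
  - by rewrite monic_neq0 // monicXnsubC.
  - by apply/allP => x; rewrite mem_enum inE rootE !hornerE subr_eq0.
  - exact: enum_uniq.
have : (#|[set x : L | x != 0%R]| <= #|fixed_units| * q.+1)%N.
  rewrite -sum1_card (partition_big norm (mem fixed_units)) /=; last first.
    by move=> x; rewrite inE => /norm_fixed.
  rewrite -sum_nat_const; apply: leq_sum => a _.
  apply: leq_trans (fib a); rewrite sum1dep_card; apply: subset_leq_card.
  by apply/fintype.subsetP => x; rewrite !inE => /andP[].
have -> : #|[set x : L | x != 0%R]| = (q ^ 2).-1.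
  by rewrite -cardL -(cardC1 (0 : L)) cardsE; apply: eq_card => x; rewrite !inE.
have -> : (q ^ 2).-1 = (q.-1 * q.+1)%N by nia.
by rewrite leq_pmul2r.
Qed.

Definition vertices : {set L * L} := [set v | v.2 \in fixed_units].

Lemma in_vertices v : (v \in vertices) = (v.2 \in fixed_units).
Proof. by rewrite finset.in_set. Qed.

Lemma card_vertices : #|vertices| = (q ^ 2 * #|fixed_units|)%N.
Proof.
rewrite -cardL -cardsT -cardsX; apply: eq_card => v; by rewrite !inE.
Qed.

Lemma fixed_units_neq0 a : a \in fixed_units -> a != 0.
Proof.
rewrite inE; apply: contraTneq => ->.
have q1 : q.-1 != 0%N by lia.
by rewrite expr0n (negbTE q1) eq_sym oner_eq0.
Qed.

Definition norm_adj (v w : L * L) : bool :=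
  [&& v \in vertices, w \in vertices & norm (v.1 + w.1) == v.2 * w.2].

Lemma norm_adjP v w : norm_adj v w -> [/\ v.2 != 0, w.2 != 0,
  v.1 + w.1 != 0 & norm (v.1 + w.1) = v.2 * w.2].
Proof.
case/and3P; rewrite !in_vertices => /fixed_units_neq0 v0 /fixed_units_neq0 w0 /eqP e.
by split => //; rewrite -norm_eq0 e mulf_neq0.
Qed.

Lemma card_norm_adj :
  ((q ^ 2).-1 * (q ^ 2 * #|fixed_units|) <= #|[set e | norm_adj e.1 e.2]|)%N.
Proof.
(* v and S = v.1 + w.1 != 0 determine the edge (v, w). *)
pose h (p : (L * L) * L) : (L * L) * (L * L) := (p.1, (p.2 - p.1.1, norm p.2 / p.1.2)).
have hinj : injective h.
  move=> [[A a] S] [[A' a'] S'] /= [-> -> ]; by move/addIr => ->.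
rewrite -card_vertices mulnC.
have -> : (q ^ 2).-1 = #|[set x : L | x != 0%R]|.
  by rewrite -cardL -(cardC1 (0 : L)) cardsE; apply: eq_card => x; rewrite !inE.
rewrite -cardsX -(card_imset _ hinj); apply: subset_leq_card.
apply/fintype.subsetP => _ /imsetP[[[A a] S] + ->]; rewrite finset.in_setX.
rewrite in_vertices finset.in_set /= => /andP[aK S0].
rewrite finset.in_set /norm_adj !in_vertices /= aK /= addrC subrK.
have a0 := fixed_units_neq0 aK.
rewrite [a * _]mulrC divfK // eqxx andbT.
(* The second coordinate N(S)/a is a quotient of two elements of F_q^*. *)
move: aK (norm_fixed S0); rewrite !inE => /eqP aK /eqP SK.
by rewrite expr_div_n aK SK divr1.
Qed.

(* Dividing the equations of (A, a) with (B_0, b_0) and (B_1, b_1) by that with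
   (B_2, b_2) eliminates a, and leaves two norm equations in 1 / (A + B_2). *)
Lemma norm_K33_free : biclique_free 3 norm_adj.
Proof.
move=> f g finj ginj H.
have Hk a b := norm_adjP (H a b).
pose B (b : 'I_3) := (g b).1.
(* The equation with one fixed vertex [f ord0] recovers the second coordinate of [g b] from the
   first. *)
have Binj : injective B.
  move=> b b' BB; apply: ginj.
  have [f0 _ _ e] := Hk ord0 b; have [_ _ _ e'] := Hk ord0 b'.
  rewrite (surjective_pairing (g b)) (surjective_pairing (g b')).
  rewrite -/(B b) BB; congr pair; apply: (mulfI f0).
  by rewrite -e -e' -/(B b) -/(B b') BB.
pose b0 : 'I_3 := inord 0; pose b1 : 'I_3 := inord 1; pose b2 : 'I_3 := inord 2.
have Bn (b b' : 'I_3) : b != b' -> B b - B b' != 0.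
  by move=> bb; rewrite subr_eq0 (inj_eq Binj).
have n02 : b0 != b2 by rewrite -val_eqE /= !inordK.
have n12 : b1 != b2 by rewrite -val_eqE /= !inordK.
have n01 : b0 != b1 by rewrite -val_eqE /= !inordK.
pose Y a := ((f a).1 + B b2)^-1.
pose C b := (B b - B b2)^-1.
have key b a : b != b2 ->
    norm (Y a + C b) = (g b).2 / ((g b2).2 * norm (B b - B b2)).
  move=> bb; have [f0 g0 fg e] := Hk a b; have [_ g2 fg2 e2] := Hk a b2.
  (* Partial fractions. In the norm of the quotient the second coordinate of [f a] cancels, so the
     value does not depend on [a]. *)
  have -> : Y a + C b = ((f a).1 + (g b).1) / (((f a).1 + (g b2).1) * (B b - B b2)).
    by rewrite /Y /C; have := Bn _ _ bb; rewrite /B => ?; field; apply/andP.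
  have normV x : norm x^-1 = (norm x)^-1 by rewrite /norm exprVn.
  rewrite normM normV normM e e2; have := Bn _ _ bb; rewrite -norm_eq0 => ?.
  by field; do ?[apply/andP; split].
apply: (@norm_pair_solutions (C b0) (C b1) _ _ Y _ (fun a => key b0 a n02) (fun a => key b1 a n12)).
  by rewrite (inj_eq invr_inj) (inj_eq (addIr _)) (inj_eq Binj).
move=> a a' /invr_inj/addIr ff; apply: finj.
rewrite (surjective_pairing (f a)) (surjective_pairing (f a')) ff; congr pair.
have [_ g0 _ e] := Hk a b0; have [_ _ _ e'] := Hk a' b0.
by apply: (mulIf g0); rewrite -e -e' ff.
Qed.

End NormGraph.

(** Numbering [S] by its enumeration embeds the graph into the first indices below n; the remaining
    indices are isolated. Thus n need not be a power of q. *)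
Lemma transport_graph (V : finType) (S : {set V}) (B : rel V) (n t : nat) :
  (#|S| <= n)%N -> (forall v w, B v w -> v \in S /\ w \in S) ->
  biclique_free t B ->
  (0 < t)%N ->
  exists B' : rel 'I_n,
    biclique_free t B' /\
    (#|[set e | B e.1 e.2]| <= #|[set e | B' e.1 e.2]|)%N.
Proof.
move=> Sn BS free t0.
have lt (v : V) : v \in S -> (index v (enum S) < n)%N.
  by move=> vS; apply: leq_trans Sn; rewrite cardE index_mem mem_enum.
case: (set_0Vmem S) => [S0|[v0 v0S]].
  exists (fun _ _ => false); split.
    (* The empty relation is biclique-free only because t > 0. *)
    by move=> f g _ _ H; have := H (Ordinal t0) (Ordinal t0).
  rewrite (eq_card0 (A := [set e | B e.1 e.2])) // => e.
  by rewrite inE; apply/negP => /BS[]; rewrite S0 inE.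
pose h (i : 'I_n) := nth v0 (enum S) i.
pose B' : rel 'I_n := fun i j => [&& (i < #|S|)%N, (j < #|S|)%N & B (h i) (h j)].
have hinj (i j : 'I_n) : (i < #|S|)%N -> (j < #|S|)%N -> h i = h j -> i = j.
  rewrite cardE => iS jS /eqP; rewrite nth_uniq ?enum_uniq // => /eqP; exact: val_inj.
exists B'; split.
  move=> f g finj ginj H; apply: (free (h \o f) (h \o g)).
  - by move=> a a' /hinj -/(_ _ _)/finj; apply;
      [have /and3P[] := H a (Ordinal t0)|have /and3P[] := H a' (Ordinal t0)].
  - by move=> a a' /hinj -/(_ _ _)/ginj; apply;
      [have /and3P[] := H (Ordinal t0) a|have /and3P[] := H (Ordinal t0) a'].
  - by move=> a b; have /and3P[] := H a b.
(* Every edge of [B] is the image under [h] of an edge of [B']. *)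
apply: leq_trans (leq_imset_card (fun e => (h e.1, h e.2)) _).
apply: subset_leq_card; apply/fintype.subsetP => -[v w]; rewrite inE /= => Bvw.
have [vS wS] := BS _ _ Bvw.
apply/imsetP; exists (Ordinal (lt _ vS), Ordinal (lt _ wS)); last first.
  by rewrite /h /= !nth_index ?mem_enum.
by rewrite inE /= /B' /= cardE !index_mem !mem_enum vS wS /h /= !nth_index ?mem_enum.
Qed.

Lemma K22_free_graph (n k : nat) : (0 < k)%N -> ((2 ^ k) ^ 2 <= n)%N ->
  exists B : rel 'I_n,
    biclique_free 2 B /\
    ((2 ^ k) ^ 3 <= #|[set e | B e.1 e.2]|)%N.
Proof.
move=> k0 kn; have [F _ cF] := @pPrimePowerField 2 k isT k0.
pose adj (v w : F * F) := v.1 + w.1 == v.2 * w.2.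
have [||||B [Bfree cB]] := @transport_graph _ [set: F * F] adj n 2.
- by rewrite cardsT card_prod cF mulnn.
- by move=> v w _; rewrite !inE.
- move=> f g finj ginj H.
  pose i1 : 'I_2 := ord_max.
  have E a b := eqP (H a b).
  by have [/finj|/ginj] := fin_K22_free (E ord0 ord0) (E ord0 i1) (E i1 ord0) (E i1 i1).
- by [].
exists B; split => //; apply: leq_trans cB.
(* A, a and b are free and determine B = ab - A, which gives q^3 edges. *)
pose h (p : F * F * F) : (F * F) * (F * F) := ((p.1.1, p.1.2), (p.1.2 * p.2 - p.1.1, p.2)).
have hinj : injective h by move=> [[A a] b] [[A' a'] b'] /= [-> -> _ ->].
have -> : ((2 ^ k) ^ 3)%N = #|h @: [set: F * F * F]|.
  by rewrite card_imset // cardsT !card_prod cF; nia.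
apply: subset_leq_card; apply/fintype.subsetP => _ /imsetP[[[A a] b] _ ->].
by rewrite inE /adj /= addrC subrK.
Qed.

Lemma K33_free_graph (n k : nat) : (0 < k)%N -> ((2 ^ k) ^ 3 <= n)%N ->
  exists B : rel 'I_n,
    biclique_free 3 B /\
    ((2 ^ k) ^ 5 <= 4 * #|[set e | B e.1 e.2]|)%N.
Proof.
move=> k0 kn; set q := (2 ^ k)%N.
have q1 : (1 < q)%N by rewrite /q -(expn0 2) ltn_exp2l.
have k20 : (0 < k * 2)%N by rewrite muln_gt0 k0.
have [L pL cL] := @pPrimePowerField 2 (k * 2) isT k20.
rewrite expnM -/q in cL.
have qD (x y : L) : (x + y) ^+ q = x ^+ q + y ^+ q.
  (* q is a power of the characteristic 2. *)
  by apply: exprDn_pchar; rewrite (eq_pnat _ (pcharf_eq pL)) pnatX.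
have [||||B [Bfree cB]] := @transport_graph _ (vertices L q) (@norm_adj L q) n 3.
- rewrite card_vertices //; apply: leq_trans kn.
  apply: leq_trans (_ : (q ^ 2 * q <= _)%N); last by rewrite -expnSr.
  rewrite leq_mul2l; apply/orP; right.
  exact: leq_trans (card_fixed_units_le cL q1) (leq_pred q).
- by move=> v w /and3P[].
- exact: norm_K33_free.
- by [].
exists B; split => //.
have c1 := card_norm_adj cL q1; have c2 := card_fixed_units_ge cL q1.
have := leq_trans c1 cB.
move: c2; set m := #|fixed_units L q|; set N := #|[set e | B _ _]| => c2 c3.
apply: leq_trans (_ : (4 * ((q ^ 2).-1 * (q ^ 2 * q.-1)) <= _)%N); last first.
  rewrite leq_mul2l; apply: leq_trans c3; by rewrite !leq_mul2l c2 !orbT.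
(* Since q >= 2, each of q^2 - 1 and q - 1 loses at most a factor 2; this is the constant 4. *)
have h1 : (q ^ 2 <= 2 * (q ^ 2).-1)%N by nia.
have h2 : (q <= 2 * q.-1)%N by lia.
have := leq_mul (leq_mul h1 h2) (leqnn (q ^ 2)).
nia.
Qed.

End FiniteFieldGraphs.

(** * Asymptotics *)

Local Open Scope classical_set_scope.
Local Open Scope ring_scope.

Lemma bigO_natP (R : realType) (f g : nat -> R) :
  (forall n, 0 <= f n) -> (forall n, 0 <= g n) ->
  (f : nat -> R^o) =O_\oo (g : nat -> R^o) <->
  exists2 C, 0 < C & \forall n \near \oo, f n <= C * g n.
Proof.
move=> f0 g0.
have fE n : `|(f n : R^o)| = f n := ger0_norm (f0 n).
have gE n : `|(g n : R^o)| = g n := ger0_norm (g0 n).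
split=> [/eqO_exP|] [C C0 H]; [|apply/eqO_exP]; exists C => //;
  by move: H; apply: filterS => n; rewrite fE gE.
Qed.

(** The t-th root of the integer bound; the exponent is (d(t - 1) + t)/t = d + 1 - d/t. *)
Lemma extremal_stack_upper_real (R : realType) (d n t : nat) (s : 'I_d -> nat)
    (P : mx01 s) : (0 < t)%N -> (0 < n)%N ->
  (extremal n (stack P t))%:R <= t%:R * n%:R ^+ d
     + (extremal n P)%:R `^ (1 / t%:R) * n%:R `^ (d%:R + 1 - d%:R / t%:R) :> R.
Proof.
move=> t0 n0; set U := extremal n _; set E := extremal n P.
have [le|/ltnW le] := leqP U (t * n ^ d).
  apply: (@le_trans _ _ (t * n ^ d)%:R); first by rewrite ler_nat.
  by rewrite natrM natrX lerDl mulr_ge0 ?powR_ge0.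
have := @extremal_stack_upper d n t s P t0; rewrite -/U -/E => key.
rewrite -lerBlDl -natrX -natrM -natrB //.
set x := (U - _)%N in key *.
have tn0 : t%:R != 0 :> R by rewrite pnatr_eq0 -lt0n.
have -> : x%:R = (x ^ t)%:R `^ (1 / t%:R) :> R.
  by rewrite natrX -powR_mulrn // -powRrM mulrCA divff // mulr1 powRr1.
have -> : d%:R + 1 - d%:R / t%:R = (d * t.-1 + t)%:R * (1 / t%:R) :> R.
  by rewrite natrD natrM -subn1 natrB //; field.
rewrite [n%:R `^ _]powRrM powR_mulrn // -powRM ?exprn_ge0 // -natrX -natrM.
apply: ge0_ler_powR; rewrite ?nnegrE ?divr_ge0 //.
by rewrite ler_nat mulnC.
Qed.

Lemma powR_nat_le (R : realType) (n : nat) (a b : R) :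
  (0 < n)%N -> a <= b -> n%:R `^ a <= n%:R `^ b.
Proof. by move=> n0 ab; apply: ler_powR => //; rewrite ler1n. Qed.

Lemma extremal_stack_bigO (R : realType) (d : nat) (t : nat) (s : 'I_d -> nat)
    (P : mx01 s) : (0 < t)%N -> (2 <= ones P)%N ->
     (fun n : nat => (extremal n (stack P t))%:R : R^o) =O_\oo
     (fun n : nat => (extremal n P)%:R `^ (1 / t%:R)
                     * n%:R `^ (d%:R + 1 - d%:R / t%:R) : R^o).
Proof.
move=> t0 P2.
have d0 : (0 < d)%N by have [x [y [i _]]] := two_ones P2; case: (d) i => // -[].
have tn0 : 0 < t%:R :> R by rewrite ltr0n.
apply/bigO_natP => //.
exists (t%:R + 1); first by rewrite ltr_wpDr.
near=> n; have n0 : (0 < n)%N by near: n; exists 1%N.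
apply: le_trans (@extremal_stack_upper_real R d n t s P t0 n0) _.
rewrite [leRHS]mulrDl; apply: lerD; last by rewrite [leRHS]mul1r.
apply: ler_wpM2l => //.
have En := extremal_lower P2 n0.
(* As ex(n, P) >= n^(d-1), the main term is at least n^(d+1-1/t) >= n^d, which absorbs t n^d. *)
apply: (@le_trans _ _ (((n ^ d.-1)%:R `^ (1 / t%:R)) * n%:R `^ (d%:R + 1 - d%:R / t%:R))); last first.
  rewrite ler_wpM2r ?powR_ge0 //; apply: ge0_ler_powR; rewrite ?nnegrE ?divr_ge0 //.
  by rewrite ler_nat.
rewrite natrX -!powR_mulrn // -powRrM -powRD; last by rewrite pnatr_eq0 -lt0n n0 implybT.
apply: powR_nat_le => //.
have -> : d.-1%:R = d%:R - 1 :> R by rewrite -subn1 natrB.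
have : 1 / t%:R <= 1 :> R by rewrite ler_pdivrMr // mul1r ler1n.
have -> : (d%:R - 1) * (1 / t%:R) + (d%:R + 1 - d%:R / t%:R) = d%:R + 1 - 1 / t%:R :> R.
  by field; rewrite gt_eqF.
lra.
Unshelve. all: by end_near. Qed.

Lemma extremal_stack_bigO_linear (R : realType) (d : nat) (hd : (0 < d)%N)
    (t : nat) (s : 'I_d -> nat) (P : mx01 s) : (0 < t)%N ->
     (fun n : nat => (extremal n P)%:R : R^o) =O_\oo
       (fun n : nat => n%:R ^+ (d - 1) : R^o) ->
     (fun n : nat => (extremal n (stack P t))%:R : R^o) =O_\oo
     (fun n : nat => n%:R `^ (d%:R + 1 - 1 / t%:R) : R^o).
Proof.
move=> t0 /bigO_natP[//|n|C C0 HC]; first exact: exprn_ge0.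
have tn0 : 0 < t%:R :> R by rewrite ltr0n.
apply/bigO_natP => //.
exists (t%:R + C `^ (1 / t%:R)); first by rewrite ltr_wpDr // powR_ge0.
near=> n; have n0 : (0 < n)%N by near: n; exists 1%N.
have Cn : (extremal n P)%:R <= C * n%:R ^+ (d - 1) by near: n.
apply: le_trans (@extremal_stack_upper_real R d n t s P t0 n0) _.
rewrite mulrDl lerD //.
  rewrite ler_wpM2l // -powR_mulrn //; apply: powR_nat_le => //.
  have : 1 / t%:R <= 1 :> R by rewrite ler_pdivrMr // mul1r ler1n.
  lra.
(* The first summand of the exponent is the t-th root of the assumed n^(d-1). *)
have -> : d%:R + 1 - 1 / t%:R = (d - 1)%:R * (1 / t%:R) + (d%:R + 1 - d%:R / t%:R) :> R.
  by rewrite natrB //; field; rewrite gt_eqF.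
rewrite [n%:R `^ (_ * _ + _)]powRD; last by rewrite pnatr_eq0 -lt0n n0 implybT.
rewrite [n%:R `^ (_ * _)]powRrM powR_mulrn // mulrA -powRM ?exprn_ge0 ?(ltW C0) //.
rewrite ler_wpM2r ?powR_ge0 //; apply: ge0_ler_powR; rewrite ?nnegrE ?divr_ge0 //.
by rewrite mulr_ge0 ?exprn_ge0 // ltW.
Unshelve. all: by end_near. Qed.

(** The largest k with 2^(kr) <= n; the assumption on n makes k = 1 a candidate. Rounding n down to
    a power costs only a constant factor. *)
Lemma pow2_bracket (r n : nat) : (0 < r)%N -> (2 ^ r <= n)%N ->
  exists k, [/\ (0 < k)%N, ((2 ^ k) ^ r <= n)%N & (n < (2 * 2 ^ k) ^ r)%N].
Proof.
move=> r0 rn; have n0 : (0 < n)%N by apply: leq_trans rn; rewrite expn_gt0.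
have ex : exists k, ((2 ^ k) ^ r <= n)%N by exists 1%N.
have bd k : ((2 ^ k) ^ r <= n)%N -> (k <= n)%N.
  move=> H; apply: leq_trans (ltnW (ltn_expl k (isT : 1 < 2)%N)) _; apply: leq_trans H.
  by rewrite -[X in (X <= _)%N]expn1 leq_pexp2l ?expn_gt0.
have [k kn kmax] := ex_maxnP ex bd.
exists k; split => //; first by apply: kmax.
by rewrite -expnS ltnNge; apply/negP => /kmax; rewrite ltnn.
Qed.

(** Common form of the cases t = 2 and t = 3. With q = 2^k, the q^(2t-1) edges on q^t indices match
    the exponent 2 - 1/t. *)
Lemma extremal_stack_Theta (R : realType) (d : nat) (hd : (0 < d)%N)
    (t : nat) (s : 'I_d -> nat) (P : mx01 s) (i : 'I_d) (u : 'I_t -> position s)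
    (c : nat) :
  (0 < t)%N -> (forall k, P (u k)) -> injective (fun k => u k i) ->
  (forall n k, (0 < k)%N -> ((2 ^ k) ^ t <= n)%N ->
    exists B : rel 'I_n,
    biclique_free t B /\
    ((2 ^ k) ^ (2 * t).-1 <= c * #|[set e | B e.1 e.2]%SET|)%N) ->
  (fun n : nat => (extremal n P)%:R : R^o) =O_\oo
    (fun n : nat => n%:R ^+ (d - 1) : R^o) ->
  (fun n : nat => (extremal n (stack P t))%:R : R^o) =Theta_\oo
  (fun n : nat => n%:R `^ (d%:R + 1 - 1 / t%:R) : R^o).
Proof.
move=> t0 Pu uinj graph PO; rewrite eqThetaE bigThetaE eqOmegaO; split.
  exact: extremal_stack_bigO_linear.
have tn0 : 0 < t%:R :> R by rewrite ltr0n.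
pose e := (2 * t).-1.
apply/bigO_natP => //.
(* The factor 2^e pays for n < (2q)^t and c for the edge count; adding 1 keeps the constant positive
   when c = 0. *)
exists (2 ^+ e * (c%:R + 1)); first by rewrite natr1 mulr_gt0 ?exprn_gt0 ?ltr0n.
near=> n; have n2 : (2 ^ t <= n)%N by near: n; exists (2 ^ t)%N.
have n0 : (0 < n)%N by apply: leq_trans n2; rewrite expn_gt0.
have [k [k0 kn nk]] := pow2_bracket t0 n2.
have [B [Bfree cB]] := graph n k k0 kn.
have := extremal_stack_lower Pu uinj Bfree.
set b := #|[set e | B e.1 e.2]%SET| in cB *; set U := extremal _ _ => low.
have -> : d%:R + 1 - 1 / t%:R = d.-1%:R + e%:R / t%:R :> R.
  rewrite /e -!subn1 !natrB ?natrM //; last by rewrite muln_gt0.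
  by field; rewrite gt_eqF.
rewrite powRD; last by rewrite pnatr_eq0 -lt0n n0 implybT.
have h1 : n%:R `^ (e%:R / t%:R) <= (2 * 2 ^ k)%:R ^+ e :> R.
  have -> : (2 * 2 ^ k)%:R ^+ e = ((2 * 2 ^ k) ^ t)%:R `^ (e%:R / t%:R) :> R.
    rewrite natrX -[in RHS]powR_mulrn // -powRrM mulrCA divff ?gt_eqF //.
    by rewrite mulr1 powR_mulrn.
  apply: ge0_ler_powR; rewrite ?nnegrE ?divr_ge0 //.
  by rewrite ler_nat ltnW.
rewrite powR_mulrn //.
apply: (@le_trans _ _ ((n ^ d.-1 * (2 * 2 ^ k) ^ e)%:R)).
  by rewrite natrM !natrX ler_wpM2l ?exprn_ge0 // -natrX.
rewrite natr1 -natrX -!natrM ler_nat expnMn.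
rewrite mulnCA -mulnA leq_mul2l; apply/orP; right.
apply: leq_trans (_ : n ^ d.-1 * (c * b) <= _)%N; first exact: leq_mul (leqnn _) cB.
by rewrite mulnCA mulSn; apply: leq_trans (leq_addl _ _); rewrite leq_mul2l low orbT.
Unshelve. all: by end_near. Qed.

Theorem theorem3p1 (R : realType) (d : nat) (hd : (0 < d)%N) :
  (forall (t : nat) (s : 'I_d -> nat) (P : mx01 s),
     (0 < t)%N -> (2 <= ones P)%N ->
     (fun n : nat => (extremal n (stack P t))%:R : R^o) =O_\oo
     (fun n : nat => (extremal n P)%:R `^ (1 / t%:R)
                     * n%:R `^ (d%:R + 1 - d%:R / t%:R) : R^o))
  /\
  (forall (t : nat) (s : 'I_d -> nat) (P : mx01 s),
     (0 < t)%N ->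
     (fun n : nat => (extremal n P)%:R : R^o) =O_\oo
       (fun n : nat => n%:R ^+ (d - 1) : R^o) ->
     (fun n : nat => (extremal n (stack P t))%:R : R^o) =O_\oo
     (fun n : nat => n%:R `^ (d%:R + 1 - 1 / t%:R) : R^o))
  /\
  (forall (s : 'I_d -> nat) (P : mx01 s),
     (2 <= ones P)%N ->
     (fun n : nat => (extremal n P)%:R : R^o) =O_\oo
       (fun n : nat => n%:R ^+ (d - 1) : R^o) ->
     (fun n : nat => (extremal n (stack P 2))%:R : R^o) =Theta_\oo
     (fun n : nat => n%:R `^ (d%:R + 1 / 2) : R^o))
  /\
  (forall (s : 'I_d -> nat) (P : mx01 s),
     (exists x y z : position s,
        [/\ P x, P y & P z] /\
        [/\ x (Ordinal hd) <> y (Ordinal hd),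
            x (Ordinal hd) <> z (Ordinal hd)
          & y (Ordinal hd) <> z (Ordinal hd)]) ->
     (fun n : nat => (extremal n P)%:R : R^o) =O_\oo
       (fun n : nat => n%:R ^+ (d - 1) : R^o) ->
     (fun n : nat => (extremal n (stack P 3))%:R : R^o) =Theta_\oo
     (fun n : nat => n%:R `^ (d%:R + 2 / 3) : R^o)).
Proof.
split; first exact: extremal_stack_bigO.
split; first exact: extremal_stack_bigO_linear.
split=> s P.
  (* Two distinct ones differ in some coordinate i, not necessarily the first. *)
  move=> /two_ones[x [y [i [Px Py xy]]]] PO.
  have -> : d%:R + 1 / 2 = d%:R + 1 - 1 / 2%:R :> R by field.
  apply: (@extremal_stack_Theta R d hd 2 s P i (fun k => if val k is 0 then x else y) 1%N) => //.
  - by case=> -[|k].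
  - move=> [[|[|//]] ?] [[|[|//]] ?] //= E; first [exact: val_inj | by rewrite E eqxx in xy].
  - by move=> n k k0 /(K22_free_graph k0)[B [Bfree cB]]; exists B; rewrite mul1n.
move=> [x [y [z [[Px Py Pz] [xy xz yz]]]]] PO.
have -> : d%:R + 2 / 3 = d%:R + 1 - 1 / 3%:R :> R by field.
apply: (@extremal_stack_Theta R d hd 3 s P (Ordinal hd)
  (fun k => match val k with 0 => x | 1 => y | _ => z end) 4%N) => //.
- by case=> -[|[|k]].
- move=> [[|[|[|//]]] ?] [[|[|[|//]]] ?] //= E; first [exact: val_inj
    | by case: (xy E) | by case: (xz E) | by case: (yz E)
    | by case: (xy (esym E)) | by case: (xz (esym E)) | by case: (yz (esym E))].
- by move=> n k k0 /(K33_free_graph k0).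
Qed.
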